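(* Let $m\in\{1,2,3,7,11\}$, let $E=\mathbb{Q}(\sqrt{-m})$ with ring of integers $\mathfrak{O}$, and let $L$ be a $2$-universal ternary Hermitian $\mathfrak{O}$-lattice. Then one of the following holds: (i) $m=1$ and $L\cong\langle 1,1,1\rangle$; (ii) $m=3$ and $L\cong\langle 1,1,1\rangle$ or $L\cong\langle 1,1,2\rangle$; (iii) $m=7$ and $L\cong\langle 1,1,1\rangle$.
   Context: A Hermitian $\mathfrak{O}$-lattice is a finitely generated $\mathfrak{O}$-submodule $L$ of a finite-dimensional $E$-vector space equipped with a form $H$ that is linear in the first variable, satisfies $H(x,y)=\overline{H(y,x)}$ (bar is complex conjugation), and has $H(L,L)\subseteq\mathfrak{O}$. Its rank is $\dim_E EL$; binary means rank 2, ternary means rank 3. It is positive (definite) if $H(v):=H(v,v)>0$ for all $0\neq v\in L$; all lattices are assumed positive. For the fields considered here every lattice is free; the Gram matrix of a lattice with basis $v_1,\dots,v_n$ is $M_L=(H(v_i,v_j))$. $\langle a_1,\dots,a_n\rangle$ denotes the free lattice with diagonal Gram matrix with entries $a_1,\dots,a_n$. $L$ represents $\ell$ (written $\ell\to L$) if $M_\ell=XM_LX^*$ for some matrix $X$ over $\mathfrak{O}$, where $X^*$ is the conjugate transpose; two lattices are isometric ($\cong$) if they represent each other. A positive Hermitian $\mathfrak{O}$-lattice is $2$-universal if it represents all binary positive Hermitian $\mathfrak{O}$-lattices. *)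

(* Defs.v *)
From HB Require Import structures.
From mathcomp Require Import all_boot all_order all_algebra all_field.
From mathcomp Require Import sesquilinear ring.

Set Implicit Arguments.
Unset Strict Implicit.
Unset Printing Implicit Defensive.

Import Order.TTheory GRing.Theory Num.Theory.
Local Open Scope ring_scope.

(* The imaginary quadratic field Q(sqrt(-m)), as a subfield of algC: the
   Q-linear combinations of 1 and sqrt(-m). *)
Definition quad_pred (m : nat) : {pred algC} :=
  Crat_span [:: 1; sqrtC (- m%:R)].

Lemma quad_predP m x :
  reflect (exists a b : rat, x = ratr a + ratr b * sqrtC (- m%:R))
          (x \in quad_pred m).
Proof.
apply: (iffP (Crat_spanP _ _)) => [[a ->]|[a [b ->]]].
  by exists (a ord0), (a (lift ord0 ord0)); rewrite !big_ord_recl big_ord0 /=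
    mulr1 addr0.
exists [ffun i : 'I_2 => if i == ord0 then a else b].
by rewrite !big_ord_recl big_ord0 /= !ffunE /= mulr1 addr0.
Qed.

Lemma quad_pred_divring m : divring_closed (quad_pred m).
Proof.
set s := sqrtC (- m%:R : algC).
have s2 : s * s = ratr (- m%:R).
  by rewrite -expr2 sqrtCK rmorphN /= ratr_nat.
split=> [|x y /quad_predP[a [b ->]] /quad_predP[c [d ->]]|
          x y /quad_predP[a [b ->]] /quad_predP[c [d ->]]].
- by apply/quad_predP; exists 1, 0; rewrite rmorph0 rmorph1 mul0r addr0.
- apply/quad_predP; exists (a - c), (b - d); rewrite !rmorphB /= -/s.
  by rewrite mulrBl opprD addrACA.
rewrite -/s.
pose N := c ^+ 2 + m%:R * d ^+ 2.
have [cd0|cd0] := eqVneq N 0.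
  have /andP[/eqP c0 /eqP md0] : (c ^+ 2 == 0) && (m%:R * d ^+ 2 == 0).
    have md_ge0 : 0 <= m%:R * d ^+ 2 by rewrite mulr_ge0 ?ler0n ?sqr_ge0.
    by rewrite -paddr_eq0 ?sqr_ge0 //; apply/eqP.
  have {}c0 : c = 0 by apply/eqP; rewrite -sqrf_eq0 c0.
  have -> : ratr c + ratr d * s = 0.
    apply/eqP; rewrite c0 rmorph0 add0r -sqrf_eq0 exprMn (expr2 s) s2 -rmorphXn.
    by rewrite -rmorphM mulrN mulrC md0 oppr0 rmorph0.
  rewrite invr0 mulr0; apply/quad_predP; exists 0, 0.
  by rewrite !rmorph0 mul0r addr0.
have NE : (ratr c + ratr d * s) * (ratr c - ratr d * s) = ratr N.
  transitivity (ratr c ^+ 2 - ratr d ^+ 2 * (s * s)); first by ring.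
  rewrite s2 -!rmorphXn -rmorphM -rmorphB /= /N.
  by congr ratr; ring.
have rN0 : ratr N != 0 :> algC by rewrite fmorph_eq0.
have y0 : ratr c + ratr d * s != 0.
  by apply: contraNneq rN0 => y0; rewrite -NE y0 mul0r.
have -> : (ratr c + ratr d * s)^-1 = (ratr c - ratr d * s) / ratr N.
  by apply: (mulfI y0); rewrite mulfV // mulrA NE mulfV.
apply/quad_predP.
exists ((a * c + m%:R * b * d) / N), ((b * c - a * d) / N).
rewrite !fmorph_div /= mulrA [X in _ = _ + X]mulrAC -mulrDl; congr (_ / _).
rewrite !(rmorphB, rmorphD, rmorphM) /=.
have {}s2 : s * s = - m%:R by rewrite s2 rmorphN /= ratr_nat.
rewrite ratr_nat.
transitivity (ratr a * ratr c - ratr b * ratr d * (s * s)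
              + (ratr b * ratr c - ratr a * ratr d) * s); first by ring.
by rewrite -/s s2; ring.
Qed.

HB.instance Definition _ m :=
  GRing.isDivringClosed.Build _ (quad_pred m) (quad_pred_divring m).

Record quadField (m : nat) :=
  QuadField { quad_val : algC; quad_valP : quad_val \in quad_pred m }.

HB.instance Definition _ m := [isSub for @quad_val m].
HB.instance Definition _ m := [Choice of quadField m by <:].
HB.instance Definition _ m :=
  [SubChoice_isSubIntegralDomain of quadField m by <:].
HB.instance Definition _ m :=
  [SubIntegralDomain_isSubField of quadField m by <:].

Lemma quad_pred_conj m (x : quadField m) : (\val x)^* \in quad_pred m.
Proof.
case: x => _ /= /quad_predP[a [b ->]]; apply/quad_predP.
set s := sqrtC _.
have /orP[/eqP sE|/eqP sE] : (s^* == s) || (s^* == - s).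
  by rewrite -eqf_sqr -rmorphXn /= sqrtCK rmorphN /= rmorph_nat.
- exists a, b; rewrite raddfD /= (rmorphM _ (ratr b)) /= -/s sE.
  by rewrite !(CrealP (Creal_Crat (Crat_rat _))).
exists a, (- b); rewrite raddfD /= (rmorphM _ (ratr b)) /= -/s sE.
by rewrite rmorphN mulrN mulNr !(CrealP (Creal_Crat (Crat_rat _))).
Qed.

Definition quad_conj m (x : quadField m) : quadField m :=
  QuadField (quad_pred_conj x).

Lemma quad_conj_zmod_morphism m : zmod_morphism (@quad_conj m).
Proof. by move=> x y; apply: val_inj; rewrite /= !rmorphB. Qed.

Lemma quad_conj_monoid_morphism m : monoid_morphism (@quad_conj m).
Proof.
by split=> [|x y]; apply: val_inj; rewrite /= ?rmorphM /= ?rmorph1.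
Qed.

HB.instance Definition _ m :=
  GRing.isZmodMorphism.Build _ _ (@quad_conj m) (@quad_conj_zmod_morphism m).
HB.instance Definition _ m :=
  GRing.isMonoidMorphism.Build _ _ (@quad_conj m)
    (@quad_conj_monoid_morphism m).

Lemma quad_conjK m : involutive (@quad_conj m).
Proof. by move=> x; apply: val_inj; rewrite /= conjCK. Qed.

HB.instance Definition _ m :=
  isInvolutive.Build _ (@quad_conj m) (@quad_conjK m).

Definition quad_int (m : nat) : {pred quadField m} :=
  fun x => \val x \in Aint.
Arguments quad_int : clear implicits.

Lemma quad_int_subring m : subring_closed (quad_int m).
Proof.
by split=> [|x y xO yO|x y xO yO]; rewrite unfold_in /= ?Aint1 ?rpredB ?rpredM.
Qed.

HB.instance Definition _ m :=
  GRing.isSubringClosed.Build _ (quad_int m) (@quad_int_subring m).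

Lemma quad_int_conj m x : x \in quad_int m -> quad_conj x \in quad_int m.
Proof. by move=> xO; rewrite unfold_in /= Aint_aut. Qed.

Definition int_span m (V : vectType (quadField m)) n (v : n.-tuple V)
    (x : V) : Prop :=
  exists2 c : 'I_n -> quadField m,
    forall i, c i \in quad_int m & x = \sum_(i < n) c i *: tnth v i.

(* The lattice is the submodule spanned by
   hl_gens over the ring of integers (see hl_mem); the ambient space hl_space
   may be larger than the subspace spanned by the lattice. Positivity is
   tested in algC, where 0 < z means that z is real and positive. *)
Record hermLattice (m : nat) := HermLattice {
  hl_space : vectType (quadField m);
  hl_form : {hermitian_sym hl_space for @quad_conj m};
  hl_ngens : nat;
  hl_gens : hl_ngens.-tuple hl_space;
  hl_integral : forall x y, int_span hl_gens x -> int_span hl_gens y ->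
    hl_form x y \in quad_int m;
  hl_positive : forall x, int_span hl_gens x -> x != 0 ->
    0 < \val (hl_form x x)
}.

Definition hl_mem m (L : hermLattice m) : hl_space L -> Prop :=
  int_span (hl_gens L).

(* The generators of L also span EL over the field E. *)
Definition hl_rank m (L : hermLattice m) : nat := \dim <<hl_gens L>>%VS.

Definition lattice_basis m (L : hermLattice m) n (v : n.-tuple (hl_space L)) :
    Prop :=
  (forall x, hl_mem x <-> int_span v x) /\
  (forall c : 'I_n -> quadField m, (forall i, c i \in quad_int m) ->
     \sum_(i < n) c i *: tnth v i = 0 -> forall i, c i = 0).

Definition gram m (L : hermLattice m) n (v : n.-tuple (hl_space L)) :
    'M[quadField m]_n :=
  \matrix_(i, j) hl_form L (tnth v i) (tnth v j).

(* represents L l is the relation l -> L. The choice of the bases w and v is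
   irrelevant, since changing either one only multiplies X by an invertible
   matrix over the ring of integers. *)
Definition represents m (L l : hermLattice m) : Prop :=
  exists (n k : nat) (w : n.-tuple (hl_space l)) (v : k.-tuple (hl_space L))
      (X : 'M[quadField m]_(n, k)),
    [/\ lattice_basis w, lattice_basis v, X \is a mxOver (quad_int m) &
        gram w = X *m gram v *m (X ^t (@quad_conj m))%sesqui].

Definition isometric m (L K : hermLattice m) : Prop :=
  represents L K /\ represents K L.

Definition two_universal m (L : hermLattice m) : Prop :=
  forall l : hermLattice m, hl_rank l = 2%N -> represents L l.

(* The lattice <a_1, ..., a_n> for positive rational integers a_i: the standard
   lattice in row vectors with the form sum_i a_i x_i (y_i)^*. *)
Section DiagLattice.
Variables (m : nat) (a : seq nat).
Let n := size a.

Definition diag_form (x y : 'rV[quadField m]_n) : quadField m :=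
  \sum_(i < n) (nth 0%N a i)%:R * x 0 i * quad_conj (y 0 i).

Lemma diag_form_bilinear :
  bilinear_for (GRing.Scale.Law.clone _ _ ( *%R ) _)
    (GRing.Scale.Law.clone _ _ (@quad_conj m \; *%R ) _) diag_form.
Proof.
split=> [y|y] c u v; rewrite /= /diag_form mulr_sumr -big_split /=.
  by apply: eq_bigr => i _; rewrite !mxE; ring.
by apply: eq_bigr => i _; rewrite !mxE rmorphD rmorphM /=; ring.
Qed.

HB.instance Definition _ :=
  bilinear_isBilinear.Build _ _ _ _ (GRing.Scale.Law.clone _ _ ( *%R ) _)
    (GRing.Scale.Law.clone _ _ (@quad_conj m \; *%R ) _) diag_form
    diag_form_bilinear.

Lemma diag_form_hermitian x y :
  diag_form x y = (-1) ^+ false * quad_conj (diag_form y x).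
Proof.
rewrite expr0 mul1r rmorph_sum; apply: eq_bigr => i _ /=.
by rewrite !rmorphM rmorph_nat /= quad_conjK mulrAC.
Qed.

HB.instance Definition _ :=
  isHermitianSesquilinear.Build _ _ _ _ diag_form diag_form_hermitian.

Definition diag_gens : n.-tuple 'rV[quadField m]_n :=
  [tuple delta_mx 0 i | i < n].

Lemma diag_spanE (c : 'I_n -> quadField m) :
  \sum_(i < n) c i *: tnth diag_gens i = \row_i c i.
Proof.
rewrite [RHS]row_sum_delta; apply: eq_bigr => i _.
by rewrite tnth_mktuple mxE.
Qed.

Lemma diag_spanP x :
  int_span diag_gens x <-> forall i, x 0 i \in quad_int m.
Proof.
split=> [[c cO ->] i|xO]; first by rewrite diag_spanE mxE.
exists (x 0) => //; rewrite diag_spanE.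
by apply/rowP=> i; rewrite mxE.
Qed.

Lemma diag_integral x y : int_span diag_gens x -> int_span diag_gens y ->
  diag_form x y \in quad_int m.
Proof.
move=> /diag_spanP xO /diag_spanP yO; apply: rpred_sum => i _.
by rewrite !rpredM ?rpred_nat ?quad_int_conj.
Qed.

Lemma diag_form_gt0 x : all (ltn 0) a -> x != 0 -> 0 < \val (diag_form x x).
Proof.
move=> /allP a_gt0 x0.
have aP (i : 'I_n) : (0 < (nth 0%N a i)%:R :> algC).
  by rewrite ltr0n; apply: a_gt0 (mem_nth 0%N (ltn_ord i)).
have vE : \val (diag_form x x) =
    \sum_(i < n) (nth 0%N a i)%:R * `|\val (x 0 i)| ^+ 2.
  rewrite /diag_form rmorph_sum; apply: eq_bigr => i _ /=.
  rewrite -mulrA -normCK; congr (_ * _).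
  exact: (rmorph_nat (\val : quadField m -> algC)).
have tP (i : 'I_n) : true -> 0 <= (nth 0%N a i)%:R * `|\val (x 0 i)| ^+ 2.
  by rewrite mulr_ge0 ?ler0n ?exprn_ge0.
rewrite vE lt_def sumr_ge0 // andbT; apply: contraNneq x0.
move/(psumr_eq0P tP) => x0; apply/eqP/rowP=> i; rewrite mxE.
have /eqP := x0 i isT; rewrite mulf_eq0 gt_eqF //= sqrf_eq0 normr_eq0.
by move/eqP=> xi0; apply: val_inj.
Qed.

Definition diag_lattice (a_gt0 : all (ltn 0) a) : hermLattice m :=
  @HermLattice m _ diag_form n diag_gens diag_integral
    (fun x _ => diag_form_gt0 a_gt0).

Lemma diag_lattice_basis (a_gt0 : all (ltn 0) a) :
  @lattice_basis m (diag_lattice a_gt0) n diag_gens.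
Proof.
split=> // c _; rewrite diag_spanE => /rowP c0 i.
by have := c0 i; rewrite !mxE.
Qed.

Lemma diag_lattice_gram (a_gt0 : all (ltn 0) a) :
  @gram m (diag_lattice a_gt0) n diag_gens =
  diag_mx (\row_i (nth 0%N a i)%:R).
Proof.
apply/matrixP=> i j; rewrite !mxE /= /diag_form !tnth_mktuple.
rewrite (bigD1 i) //= big1 => [|k ki]; last first.
  by rewrite !mxE (negPf ki) mulr0 mul0r.
rewrite !mxE !eqxx mulr1 addr0 andTb.
by case: eqP => _; rewrite ?rmorph1 ?rmorph0 ?mulr1 ?mulr0.
Qed.

End DiagLattice.

Arguments diag_lattice : clear implicits.

(* Main.v *)
Require Import Defs.
From mathcomp Require Import all_boot.
From mathcomp Require Import all_order all_algebra all_field.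
From mathcomp Require Import sesquilinear boolp ring lra zify.

Set Implicit Arguments.
Unset Strict Implicit.
Unset Printing Implicit Defensive.

Import Order.TTheory GRing.Theory Num.Theory.

(** A 2-universal lattice L represents <1,1>, so it contains two orthonormal
    vectors, and O e1 + O e2 splits off L. The five rings O are norm-Euclidean
    ([quad_euclid]), hence the orthogonal complement, of rank 1, is generated by
    any nonzero vector e3 of minimal norm, and L is <1,1,a> for some a > 0
    ([split_two_units]).

    It remains to bound a, in each case with one binary lattice
    [[p,b],[b',r]] that L has to represent. In coordinates ([universal_coords])
    this asks for vectors x, y of O^3 of norms p and r with product b for the
    form x0 y0' + x1 y1' + a x2 y2' ([herm3]), where z' is the conjugate of z.

    - For m = 1 and m = 7 take p = r = 2, b = 1. If a >= 2, the third coordinates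
      vanish: otherwise a = 2 and the other coordinates of x or of y vanish,
      so 1 = b is twice an element of O. Then the Gram determinant 3
      is the norm of x0 y1 - x1 y0, but 3 is not a norm from O. So a = 1.
    - For m = 3 take p = 1, r = 2, b = 0. If a >= 3, the third coordinates vanish
      because the norms are at most 2, and the Gram determinant 2 would be
      a norm from O, which it is not. So a <= 2.
    - For m = 2 and m = 11 take p = r = 2 and an element b of norm 3 of which
      conjugation does not just change the sign ([norm3_entry]). In a vector of
      norm 2, conjugation multiplies all coordinates by a common sign, so it
      multiplies the product of two such vectors by a sign
      ([norm2_pair_conj]). So no a is possible. *)

(** * Arithmetic of the rings of integers *)

Section Arithmetic.
Local Open Scope ring_scope.
Variable m : nat.
Implicit Types x y : quadField m.

Let sq : algC := sqrtC (- m%:R).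

Lemma sqK : sq * sq = - m%:R. Proof. by rewrite -expr2 sqrtCK. Qed.

Lemma quad_sqrt_subproof : sq \in quad_pred m.
Proof. by apply/quad_predP; exists 0, 1; rewrite rmorph0 rmorph1 add0r mul1r. Qed.

Definition quad_sqrt : quadField m := QuadField quad_sqrt_subproof.

Lemma val_natr n : \val (n%:R : quadField m) = n%:R.
Proof. exact: (rmorph_nat (\val : quadField m -> algC)). Qed.

Lemma val_intr (n : int) : \val (n%:~R : quadField m) = n%:~R.
Proof. exact: (rmorph_int (\val : quadField m -> algC)). Qed.

Lemma quad_natr_inj : injective (fun n : nat => n%:R : quadField m).
Proof.
by move=> a b /(congr1 val) /=; rewrite !val_natr => /eqP; rewrite eqr_nat => /eqP.
Qed.

Lemma quad_sqrtK : quad_sqrt * quad_sqrt = - m%:R.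
Proof. by apply: val_inj; rewrite rmorphN rmorphM /= val_natr sqK. Qed.

Lemma quad_conj_sqrt : (0 < m)%N -> quad_conj quad_sqrt = - quad_sqrt.
Proof.
move=> m_gt0; apply: val_inj; rewrite /= -/sq.
have /orP[/eqP sE|/eqP //] : (sq^* == sq) || (sq^* == - sq)%C.
  by rewrite -eqf_sqr -rmorphXn /= sqrtCK rmorphN /= rmorph_nat.
have := mul_conjC_ge0 sq; rewrite sE sqK oppr_ge0 lern0 => /eqP m0.
by rewrite m0 in m_gt0.
Qed.

Hypothesis m_in : m \in [:: 1; 2; 3; 7; 11]%N.

Lemma m_gt0 : (0 < m)%N.
Proof. by move: m_in; rewrite !inE; lia. Qed.

(** In lowest terms, the square of the denominator of r divides m, which is
    squarefree. *)
Lemma int_of_mulr_sqr (r : rat) (k : int) : m%:R * r ^+ 2 = k%:~R ->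
  exists B : int, r = B%:~R.
Proof.
move=> rk; suff d1 : denq r = 1 by exists (numq r); rewrite -[LHS]divq_num_den d1 divr1.
have d_gt0 := denq_gt0 r.
have eqZ : m%:Z * numq r ^+ 2 = k * denq r ^+ 2.
  apply: (@intr_inj rat); rewrite (intrM _ m) (intrM _ k) !rmorphXn /= -rk.
  by rewrite numqE; ring.
have dvd_d : (`|denq r| ^ 2 %| m)%N.
  rewrite -(@Gauss_dvdl _ _ (`|numq r| ^ 2)); last first.
    by rewrite coprimeXl // coprimeXr // coprime_sym coprime_num_den.
  apply/dvdnP; exists `|k|%N.
  by have := congr1 absz eqZ; rewrite (abszM m) (abszM k) !abszX.
(* A square divisor of m has to be 1: only 4 and 9 are at most 11, and
   neither divides m. *)
have d_le3 : (`|denq r| <= 3)%N.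
  have := dvdn_leq m_gt0 dvd_d; move: m_in; rewrite !inE; nia.
have : (0 < `|denq r|)%N by lia.
case: (denq r) d_gt0 d_le3 dvd_d => // -[|[|[|[|d]]]] //= _ _; move: m_in;
  by rewrite !inE => /or4P[||| /orP[]] /eqP->.
Qed.

Lemma conj_quad_sqrt : (sq^* = - sq)%C.
Proof. exact: (congr1 (@quad_val m) (quad_conj_sqrt m_gt0)). Qed.

Lemma conj_ratr (a : rat) : ((ratr a : algC)^* = ratr a)%C.
Proof. exact: CrealP (Creal_Crat (Crat_rat a)). Qed.

Lemma conj_quadE (a b : rat) :
  ((ratr a + ratr b * sq)^* = ratr a - ratr b * sq)%C.
Proof. by rewrite rmorphD (rmorphM _ (ratr b)) /= !conj_ratr conj_quad_sqrt mulrN. Qed.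

Lemma norm_quadE (a b : rat) :
  ((ratr a + ratr b * sq) * (ratr a + ratr b * sq)^* = ratr (a ^+ 2 + m%:R * b ^+ 2))%C.
Proof.
rewrite conj_quadE rmorphD rmorphM !rmorphXn /= ratr_nat.
transitivity (ratr a ^+ 2 - ratr b ^+ 2 * (sq * sq)); first by ring.
by rewrite sqK; ring.
Qed.

(** The trace and the norm of x are rational algebraic integers, hence integers;
    that B is an integer follows from m B^2 = 4 N - A^2. The equation in the
    conclusion carries the parity condition that describes O for each m. *)
Lemma quad_int_coords x : x \in quad_int m ->
  exists A B : int, exists N : nat,
  [/\ x *+ 2 = A%:~R + B%:~R * quad_sqrt, x * quad_conj x = N%:R &
      A ^+ 2 + m%:Z * B ^+ 2 = 4 * N%:Z].
Proof.
move=> xO; have xcO : (\val x)^*%C \in Aint by rewrite Aint_aut.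
have /quad_predP[a [b xE]] := quad_valP x; rewrite -/sq in xE.
have [A aE] : exists A : int, a *+ 2 = A%:~R.
  have /Cint_rat_Aint /intrP : ratr (a *+ 2) \in Aint.
    have -> : ratr (a *+ 2) = \val x + (\val x)^*%C.
      by rewrite [\val x]xE conj_quadE rmorphMn /=; ring.
    exact: rpredD.
  case=> [|A]; first exact: Crat_rat.
  by rewrite -ratr_int => /fmorph_inj ->; exists A.
have [N nE] : exists N : int, a ^+ 2 + m%:R * b ^+ 2 = N%:~R.
  have /Cint_rat_Aint /intrP : ratr (a ^+ 2 + m%:R * b ^+ 2) \in Aint.
    by rewrite -norm_quadE -xE rpredM.
  case=> [|N]; first exact: Crat_rat.
  by rewrite -ratr_int => /fmorph_inj ->; exists N.
have [B bE] : exists B : int, b *+ 2 = B%:~R.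
  apply: (@int_of_mulr_sqr _ (4 * N - A ^+ 2)).
  rewrite rmorphB rmorphM rmorphXn /= -nE -aE; ring.
have N_ge0 : 0 <= N.
  have q_ge0 (c : rat) : 0 <= c ^+ 2 by rewrite sqr_ge0.
  by rewrite -(ler0z rat) -nE addr_ge0 // mulr_ge0.
case: N N_ge0 nE => // N _ nE.
exists A, B, N; split.
- apply: val_inj; rewrite rmorphMn rmorphD rmorphM /= !val_intr xE -/sq.
  by rewrite -(ratr_int algC A) -(ratr_int algC B) -aE -bE !rmorphMn /=; ring.
- by apply: val_inj; rewrite rmorphM /= xE norm_quadE nE ratr_int val_natr.
- apply: (@intr_inj rat).
  by rewrite intrD (intrM _ m) (intrM _ 4) !rmorphXn /= -nE -aE -bE; ring.
Qed.

(** The element is a root of X^2 - A X + N, where 4 N = A^2 + m B^2. *)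
Lemma quad_half_int (A B : int) : (4 %| A ^+ 2 + m%:Z * B ^+ 2)%Z ->
  (A%:~R + B%:~R * quad_sqrt) / 2 \in quad_int m.
Proof.
move=> /dvdzP[N NE]; set x : quadField m := (_ / 2).
have two_neq0 : (2 : quadField m) != 0.
  by apply/eqP=> /(@quad_natr_inj 2 0).
have root_x : x ^+ 2 - A%:~R * x + N%:~R = 0.
  have NE' : N%:~R * 4 = A%:~R ^+ 2 + m%:R * B%:~R ^+ 2 :> quadField m.
    by rewrite -(intrM _ N 4) -NE intrD (intrM _ m) !rmorphXn.
  apply: (mulIf two_neq0); apply: (mulIf two_neq0); rewrite mul0r.
  transitivity (B%:~R ^+ 2 * (quad_sqrt * quad_sqrt) - A%:~R ^+ 2 + N%:~R * 4
                : quadField m).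
    by rewrite /x; field.
  by rewrite quad_sqrtK NE'; ring.
have {root_x} : (\val x) ^+ 2 - A%:~R * \val x + N%:~R = 0.
  move/(congr1 \val): root_x.
  by rewrite rmorphD rmorphB rmorphXn rmorphM /= !val_intr.
rewrite unfold_in; move: (\val x) => z root_z.
pose p : {poly algC} := 'X^2 + ((- A)%:~R%:P * 'X + N%:~R%:P).
apply: (@root_monic_Aint p).
- by rewrite rootE /p !hornerE rmorphN mulNr -[eqbLHS]/(z ^+ 2 - A%:~R * z + N%:~R) root_z.
- rewrite monicE lead_coefDl ?lead_coefXn // size_polyXn ltnS.
  by rewrite size_MXaddC; case: ifP => // _; rewrite ltnS size_polyC_leq1.
- apply/polyOverP=> i; rewrite /p !coefD coefXn coefMX !coefC.
  by case: i => [|[|[|i]]] /=; rewrite ?rpredD ?rpred0 ?rpred1 ?intr_int.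
Qed.

Lemma round_rat (r : rat) : exists k : int, (r - k%:~R) ^+ 2 <= 1 / 4.
Proof.
exists (Num.floor (r + 1 / 2)).
have /andP[] := floor_itv (r + 1 / 2); rewrite intrD; set k := _%:~R; nra.
Qed.

(** O is norm-Euclidean. Writing x = a + b sqrt(-m) and q = (A + B sqrt(-m)) / 2,
    it suffices to make (a - A/2)^2 + m (b - B/2)^2 smaller than 1. If m <= 2,
    taking A/2 and B/2 to be the nearest integers gives at most 1/4 + m/4. If
    m = 3 modulo 4, B may be any integer, provided that A has the same parity;
    this gives at most 1/4 + m/16, which is at most 15/16. *)
Lemma quad_euclid x : exists2 q, q \in quad_int m &
  exists2 r : rat, \val ((x - q) * quad_conj (x - q)) = ratr r & r < 1.
Proof.
have /quad_predP[a [b xE]] := quad_valP x; rewrite -/sq in xE.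
suff [A [B [dvd4 lt1]]] : exists A B : int, (4 %| A ^+ 2 + m%:Z * B ^+ 2)%Z /\
    (a - A%:~R / 2) ^+ 2 + m%:R * (b - B%:~R / 2) ^+ 2 < 1.
  exists ((A%:~R + B%:~R * quad_sqrt) / 2); first exact: quad_half_int.
  eexists; last exact: lt1.
  have dE : \val (x - (A%:~R + B%:~R * quad_sqrt) / 2) =
    ratr (a - A%:~R / 2) + ratr (b - B%:~R / 2) * sq.
    rewrite rmorphB fmorph_div rmorphD rmorphM /= !val_intr xE -/sq.
    by rewrite !rmorphB !fmorph_div /= !ratr_int ratr_nat; ring.
  by rewrite -norm_quadE -dE rmorphM.
have [m_le2|m_gt2] := leqP m 2.
  have [A hA] := round_rat a; have [B hB] := round_rat b.
  exists (2 * A), (2 * B); split.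
    by apply/dvdzP; exists (A ^+ 2 + m%:Z * B ^+ 2); ring.
  have m_le : m%:R <= 2 :> rat by rewrite ler_nat.
  rewrite !intrM.
  have half2 (k : int) : 2%:~R * k%:~R / 2 = k%:~R :> rat by field.
  by rewrite !half2; have := sqr_ge0 (b - B%:~R); nra.
have [B hB] := round_rat (b *+ 2); have [A hA] := round_rat (a - B%:~R / 2).
exists (2 * A + B), B; split.
  have [k mE] : exists k : int, m%:Z + 1 = 4 * k.
    by move: m_in m_gt2; rewrite !inE => /or4P[||| /orP[]] /eqP-> // _;
      [exists 1 | exists 2 | exists 3].
  apply/dvdzP; exists (A ^+ 2 + A * B + k * B ^+ 2).
  have -> : m%:Z = 4 * k - 1 by rewrite -mE addrK.
  by ring.
have m_le : m%:R <= 11 :> rat by rewrite ler_nat; move: m_in; rewrite !inE; lia.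
rewrite intrD intrM.
have {}hA : (a - (2%:~R * A%:~R + B%:~R) / 2) ^+ 2 <= 1 / 4.
  by apply: le_trans hA; rewrite le_eqVlt; apply/orP; left; apply/eqP; field.
have {}hB : (b - B%:~R / 2) ^+ 2 <= 1 / 16.
  have -> : (b - B%:~R / 2) ^+ 2 = (b *+ 2 - B%:~R) ^+ 2 / 4 by field.
  lra.
have := sqr_ge0 (b - B%:~R / 2); nra.
Qed.

Lemma quad_norm_eq0 x : (x * quad_conj x == 0) = (x == 0).
Proof. by rewrite mulf_eq0 fmorph_eq0 orbb. Qed.

End Arithmetic.

(** * Integral spans and Hermitian forms *)

Section IntSpan.
Local Open Scope ring_scope.
Variables (m : nat) (V : vectType (quadField m)) (n : nat) (v : n.-tuple V).
Implicit Types x y : V.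

Lemma int_span_tnth i : int_span v (tnth v i).
Proof.
exists (fun j => (j == i)%:R) => [j|]; first by rewrite rpred_nat.
rewrite (bigD1 i) //= eqxx scale1r big1 ?addr0 // => j /negPf->.
by rewrite scale0r.
Qed.

Lemma int_span_add x y : int_span v x -> int_span v y -> int_span v (x + y).
Proof.
move=> [c cO ->] [d dO ->]; exists (fun i => c i + d i) => [i|].
  by rewrite rpredD.
by rewrite -big_split; apply: eq_bigr => i _; rewrite scalerDl.
Qed.

Lemma int_span_scale c x : c \in quad_int m -> int_span v x -> int_span v (c *: x).
Proof.
move=> cO [d dO ->]; exists (fun i => c * d i) => [i|]; first by rewrite rpredM.
by rewrite scaler_sumr; apply: eq_bigr => i _; rewrite scalerA.
Qed.

Lemma int_span_sub x y : int_span v x -> int_span v y -> int_span v (x - y).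
Proof.
move=> vx vy; rewrite -scaleN1r; apply: int_span_add => //.
by apply: int_span_scale => //; rewrite rpredN rpred1.
Qed.

Lemma int_span_sum (I : finType) (F : I -> V) :
  (forall i, int_span v (F i)) -> int_span v (\sum_i F i).
Proof.
move=> vF; elim/big_ind: _ => // [|x y]; last exact: int_span_add.
exists (fun=> 0) => [i|]; first by rewrite rpred0.
by rewrite big1 // => i _; rewrite scale0r.
Qed.

End IntSpan.

Section HermitianForm.
Local Open Scope ring_scope.
Variables (m : nat) (V : vectType (quadField m)).
Variable H : {hermitian_sym V for @quad_conj m}.

Lemma herm_scalel c x y : H (c *: x) y = c * H x y.
Proof. by rewrite linearZl_LR. Qed.

Lemma herm_scaler c x y : H x (c *: y) = quad_conj c * H x y.
Proof. by rewrite linearZr_LR. Qed.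

Lemma herm_conj x y : quad_conj (H x y) = H y x.
Proof. by rewrite (hermC H y x) expr0 mul1r. Qed.

Lemma herm_sum (I J : finType) (c : I -> quadField m) (d : J -> quadField m)
    (x : I -> V) (y : J -> V) :
  H (\sum_i c i *: x i) (\sum_j d j *: y j) =
  \sum_i \sum_j c i * quad_conj (d j) * H (x i) (y j).
Proof.
rewrite linear_sumlz; apply: eq_bigr => i _; rewrite linear_sumr.
by apply: eq_bigr => j _; rewrite -[LHS]/(H _ _) herm_scalel herm_scaler mulrA.
Qed.

Lemma herm_span_int n (v : n.-tuple V) :
    (forall i j, H (tnth v i) (tnth v j) \in quad_int m) ->
  forall x y, int_span v x -> int_span v y -> H x y \in quad_int m.
Proof.
move=> vO x y [c cO ->] [d dO ->]; rewrite herm_sum.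
apply: rpred_sum => i _; apply: rpred_sum => j _.
by rewrite !rpredM ?quad_int_conj.
Qed.

End HermitianForm.

(** * Representations by lattices *)

Section Representation.
Local Open Scope ring_scope.
Variable m : nat.
Implicit Types L l : hermLattice m.

(** The matrix X of a representation maps a basis of l to vectors of L with the
    same Gram matrix, and this extends to integral combinations. Stated for
    pairs, it no longer mentions the bases and the matrix. *)
Lemma represents_pair L l x y : represents L l -> hl_mem x -> hl_mem y ->
  exists x' y', [/\ @hl_mem m L x', @hl_mem m L y',
    hl_form L x' x' = hl_form l x x, hl_form L y' y' = hl_form l y y &
    hl_form L x' y' = hl_form l x y].
Proof.
move=> [n [k [w [v [X [[w_span _] [v_span _] /mxOverP XO gramE]]]]]].
pose u i := \sum_j X i j *: tnth v j.
have uE i j : hl_form L (u i) (u j) = hl_form l (tnth w i) (tnth w j).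
  have := congr1 (fun M : 'M_n => M i j) gramE.
  rewrite /gram [LHS]mxE => ->; rewrite herm_sum mxE.
  under [RHS]eq_bigr do rewrite !mxE mulr_suml.
  rewrite exchange_big; apply: eq_bigr => p _; apply: eq_bigr => q _.
  by rewrite !mxE mulrAC.
have u_mem i : hl_mem (u i) by apply/v_span; exists (X i).
move=> /w_span[c cO xE] /w_span[d dO yE].
exists (\sum_i c i *: u i), (\sum_i d i *: u i).
rewrite xE yE !herm_sum; split.
- by apply: int_span_sum => i; apply: int_span_scale (cO i) (u_mem i).
- by apply: int_span_sum => i; apply: int_span_scale (dO i) (u_mem i).
- by apply: eq_bigr => i _; apply: eq_bigr => j _; rewrite uE.
- by apply: eq_bigr => i _; apply: eq_bigr => j _; rewrite uE.
- by apply: eq_bigr => i _; apply: eq_bigr => j _; rewrite uE.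
Qed.

Lemma same_gram_represents L l n (v : n.-tuple (hl_space L))
    (w : n.-tuple (hl_space l)) :
  lattice_basis v -> lattice_basis w -> gram w = gram v -> represents L l.
Proof.
move=> v_basis w_basis gramE; exists n, n, w, v, 1%:M; split=> //.
  by apply/mxOverP=> i j; rewrite mxE rpred_nat.
by rewrite trmx1 map_mx1 mul1mx mulmx1.
Qed.

Lemma isometric_diag L (s : seq nat) (s_gt0 : all (ltn 0) s)
    (v : (size s).-tuple (hl_space L)) :
  lattice_basis v -> gram v = diag_mx (\row_i (nth 0%N s i)%:R) ->
  isometric L (diag_lattice m s s_gt0).
Proof.
move=> v_basis vE; have e_basis := @diag_lattice_basis m s s_gt0.
have gramE := diag_lattice_gram m s_gt0.
by split; [apply: same_gram_represents v_basis e_basis _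
          | apply: same_gram_represents e_basis v_basis _]; rewrite vE.
Qed.

(** The binary lattice [[p,b],[b',r]] with determinant D = p r - b b' is
    realised inside the Hermitian space <p, p D> (b' is the conjugate of b), where
    positivity is known: its basis is (1, 0) and (b'/p, 1/p). *)
Section BinaryLattice.
Variables (p r D : nat) (b : quadField m).
Hypotheses (p_gt0 : (0 < p)%N) (D_gt0 : (0 < D)%N) (bO : b \in quad_int m).
Hypothesis detE : b * quad_conj b + D%:R = (p * r)%:R.

Let s := [:: p; p * D]%N.

Lemma binary_diag_gt0 : all (ltn 0) s.
Proof. by rewrite /= muln_gt0 p_gt0 D_gt0. Qed.

Definition binary_row (x y : quadField m) : 'rV[quadField m]_(size s) :=
  \row_i [:: x; y]`_i.

Lemma binary_diag_formE x y x' y' :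
  diag_form (binary_row x y) (binary_row x' y') =
  p%:R * x * quad_conj x' + (p * D)%:R * y * quad_conj y'.
Proof.
by rewrite /diag_form !big_ord_recl big_ord0 !mxE /= addr0.
Qed.

Definition binary_gens : 2.-tuple 'rV[quadField m]_(size s) :=
  [tuple binary_row 1 0; binary_row (quad_conj b / p%:R) p%:R^-1].

Lemma p_neq0 : p%:R != 0 :> quadField m.
Proof. by apply/eqP=> /(@quad_natr_inj _ p 0) p0; move: p_gt0; rewrite p0. Qed.

Lemma binary_gram :
  [/\ diag_form (tnth binary_gens 0) (tnth binary_gens 0) = p%:R,
      diag_form (tnth binary_gens 1) (tnth binary_gens 1) = r%:R,
      diag_form (tnth binary_gens 0) (tnth binary_gens 1) = b &
      diag_form (tnth binary_gens 1) (tnth binary_gens 0) = quad_conj b].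
Proof.
have p0 := p_neq0.
rewrite !(tnth_nth 0) /= !binary_diag_formE !(rmorph0, rmorph1, fmorphV, rmorphM).
rewrite /= !rmorph_nat quad_conjK; split; [by field | | by field | by field].
by apply: (mulfI p0); rewrite -[RHS]natrM -detE; field.
Qed.

Lemma binary_integral x y : int_span binary_gens x -> int_span binary_gens y ->
  diag_form x y \in quad_int m.
Proof.
have [E00 E11 E01 E10] := binary_gram.
apply: (herm_span_int (H := @diag_form m s)) => i j.
have I2 (k : 'I_2) : k = 0 \/ k = 1.
  by case: k => [[|[|]]] //= kP; [left | right]; apply: val_inj.
by have [->|->] := I2 i; have [->|->] := I2 j;
  rewrite /= ?E00 ?E11 ?E01 ?E10 ?quad_int_conj ?rpred_nat.
Qed.

Definition binary_lattice : hermLattice m :=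
  @HermLattice m _ (@diag_form m s) 2 binary_gens binary_integral
    (fun x _ => @diag_form_gt0 m s x binary_diag_gt0).

Lemma binary_rank : hl_rank binary_lattice = 2%N.
Proof.
rewrite /hl_rank; apply/eqP; rewrite -[2%N]/(size (hl_gens binary_lattice)).
apply/freeP=> c /rowP c0.
have := c0 1; have := c0 0.
rewrite !big_ord_recl big_ord0 !mxE /=.
move=> E0 E1.
have c1 : c (lift ord0 ord0) = 0.
  move/eqP: E1; rewrite mulr0 add0r addr0 mulf_eq0 invr_eq0 (negPf p_neq0).
  by rewrite orbF => /eqP.
have c2 : c ord0 = 0 by move: E0; rewrite c1 mul0r !addr0 mulr1.
by case=> [[|[|]]] //= i2; [rewrite -c2 | rewrite -c1]; congr c; apply: val_inj.
Qed.

(** All test lattices enter the proof through this lemma. *)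
Lemma universal_pair L : two_universal L ->
  exists x y, [/\ @hl_mem m L x, @hl_mem m L y, hl_form L x x = p%:R,
    hl_form L y y = r%:R & hl_form L x y = b].
Proof.
move=> /(_ _ binary_rank) Lrep; have [E00 E11 E01 _] := binary_gram.
have [x [y [xL yL Hx Hy Hxy]]] :=
  represents_pair Lrep (int_span_tnth _ 0) (int_span_tnth _ 1).
by exists x, y; rewrite Hx Hy Hxy /= E00 E11 E01.
Qed.

End BinaryLattice.

End Representation.

(** * Splitting off two units *)

Section Splitting.
Local Open Scope ring_scope.
Variable m : nat.
Hypothesis m_in : m \in [:: 1; 2; 3; 7; 11]%N.

(** An algebraic integer of E fixed by conjugation is rational. *)
Lemma quad_int_nat (x : quadField m) :
  x \in quad_int m -> quad_conj x = x -> 0 <= \val x -> exists n : nat, x = n%:R.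
Proof.
move=> xO xc x_ge0; have /quad_predP[a [b xE]] := quad_valP x.
have := congr1 (@quad_val m) xc; rewrite [quad_val (quad_conj x)]/= xE.
rewrite (conj_quadE m_in) => xcE.
have x_rat : \val x \in Crat.
  suff -> : \val x = ratr a by apply: Crat_rat.
  rewrite [\val x]xE; suff -> : ratr b * sqrtC (- m%:R) = 0 :> algC by rewrite addr0.
  by move/addrI: xcE => /eqP; rewrite eqNr => /eqP.
have /intrP[k xk] := Cint_rat_Aint x_rat xO.
move: x_ge0; rewrite xk ler0z; case: k xk => // n xn _.
by exists n; apply: val_inj; rewrite val_natr.
Qed.

Lemma ord3P (Q : 'I_3 -> Prop) : Q 0 -> Q 1 -> Q 2%:R -> forall i, Q i.
Proof.
by move=> Q0 Q1 Q2 [[|[|[|]]] //= i3];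
  [move: Q0 | move: Q1 | move: Q2]; congr Q; exact: val_inj.
Qed.

Variable L : hermLattice m.
Implicit Types x y : hl_space L.
Local Notation H := (hl_form L).

Lemma hl_norm_ge0 x : hl_mem x -> 0 <= \val (H x x).
Proof.
move=> xL; have [->|x0] := eqVneq x 0; last exact/ltW/hl_positive.
by rewrite linear0l.
Qed.

Lemma hl_norm_nat x : hl_mem x -> exists n : nat, H x x = n%:R.
Proof.
move=> xL; apply: quad_int_nat (hl_norm_ge0 xL); first exact: hl_integral.
exact: herm_conj.
Qed.

Lemma hl_norm_eq0 x : hl_mem x -> H x x = 0 -> x = 0.
Proof.
move=> xL x0; apply/eqP; apply: contraT => /(hl_positive xL).
by rewrite x0 ltxx.
Qed.

(** The Fourier expansion; the dimension count makes it hold for all of L, as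
    the e_i span the same space over E as L does. *)
Lemma orthogonal_basis n (e : n.-tuple (hl_space L)) : hl_rank L = n ->
    (forall i, hl_mem (tnth e i)) ->
    (forall i, H (tnth e i) (tnth e i) != 0) ->
    (forall i j, i != j -> H (tnth e i) (tnth e j) = 0) ->
  free e /\ forall x, hl_mem x ->
    x = \sum_i (H x (tnth e i) / H (tnth e i) (tnth e i)) *: tnth e i.
Proof.
move=> rankL eL e_neq0 e_orth.
have coordE c i : H (\sum_j c j *: tnth e j) (tnth e i) =
    c i * H (tnth e i) (tnth e i).
  rewrite linear_sumlz (bigD1 i) //= herm_scalel big1 ?addr0 // => j ji.
  by rewrite herm_scalel e_orth // mulr0.
have free_e : free e.
  apply/freeP=> c c0 i; apply: (mulIf (e_neq0 i)).
  rewrite mul0r -coordE; under eq_bigr do rewrite (tnth_nth 0).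
  by rewrite c0 linear0l.
have mem_gens x : hl_mem x -> x \in <<hl_gens L>>%VS.
  case=> c _ ->; apply: memv_suml => i _; apply: memvZ; apply: memv_span.
  exact: mem_tnth.
split=> // x /mem_gens xL.
have /andP[/eqP spanE _] : basis_of <<hl_gens L>>%VS e.
  rewrite basisEfree free_e size_tuple -/(hl_rank L) rankL leqnn andbT.
  by apply/span_subvP=> _ /tnthP[i ->]; apply: mem_gens.
move: xL; rewrite -spanE => /coord_span xE.
have {}xE : x = \sum_i coord e i x *: tnth e i.
  by rewrite {1}xE; apply: eq_bigr => i _; rewrite (tnth_nth 0).
rewrite {1}xE; apply: eq_bigr => i _; congr (_ *: _).
by rewrite {2}xE coordE mulfK.
Qed.

Hypotheses (L_ternary : hl_rank L = 3%N) (L_universal : two_universal L).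

(** The generator e3 of the complement of e1 and e2 is a nonzero vector of
    minimal norm a. A vector P x of the complement is c e3 with c in E; if q in O
    is such that c - q has norm less than 1, then P x - q e3 has norm less
    than a, so it is 0. *)
Lemma split_two_units : exists (a : nat) (e : 3.-tuple (hl_space L)),
  [/\ (0 < a)%N, lattice_basis e &
      gram e = diag_mx (\row_i (nth 0%N [:: 1; 1; a]%N i)%:R)].
Proof.
have [e1 [e2 [e1L e2L E11 E22 E12]]] : exists x y, [/\ @hl_mem m L x,
    @hl_mem m L y, H x x = 1%:R, H y y = 1%:R & H x y = 0].
  by apply: (@universal_pair _ 1 1 1) => //; rewrite ?rpred0 // mul0r add0r.
have E21 : H e2 e1 = 0 by rewrite -herm_conj E12 rmorph0.
(* The orthogonal projection; it preserves L as e1 and e2 have norm 1. *)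
pose P x := x - (H x e1 *: e1 + H x e2 *: e2).
have P_mem x : hl_mem x -> hl_mem (P x).
  move=> xL; apply: int_span_sub => //.
  by apply: int_span_add; apply: int_span_scale; rewrite ?hl_integral.
have Pe1 x : H (P x) e1 = 0.
  by rewrite linearBl linearDl /= !herm_scalel E11 E21 mulr1 mulr0 addr0 subrr.
have Pe2 x : H (P x) e2 = 0.
  by rewrite linearBl linearDl /= !herm_scalel E22 E12 mulr1 mulr0 add0r subrr.
pose orth x := [/\ @hl_mem m L x, x != 0, H x e1 = 0 & H x e2 = 0].
pose attained n := `[< exists2 x, orth x & H x x = n%:R >].
have ex_attained : exists n, attained n.
  (* Otherwise e1 and e2 would span EL, which has dimension 3. *)
  have [x xL Px0] : exists2 x, @hl_mem m L x & P x != 0.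
    apply: contrapT => noP.
    have gens_sub : (<<hl_gens L>> <= <<[:: e1; e2]>>)%VS.
      apply/span_subvP=> _ /tnthP[i ->]; set g := tnth _ i.
      have gL : @hl_mem m L g by apply: int_span_tnth.
      have /eqP : P g = 0.
        by apply/eqP; apply: contraT => Pg; case: noP; exists g.
      rewrite subr_eq0 => /eqP->.
      by rewrite rpredD ?rpredZ ?memv_span ?inE ?eqxx ?orbT.
    have := dimvS gens_sub; rewrite -/(hl_rank L) L_ternary => dim3.
    by have := leq_trans dim3 (dim_span _).
  have [n Hn] := hl_norm_nat (P_mem _ xL).
  by exists n; apply/asboolP; exists (P x) => //; split=> //; apply: P_mem.
case: (ex_minnP ex_attained) => a /asboolP[e3 [e3L e3n0 E31 E32] E33] a_min.
have E13 : H e1 e3 = 0 by rewrite -herm_conj E31 rmorph0.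
have E23 : H e2 e3 = 0 by rewrite -herm_conj E32 rmorph0.
have a_gt0 : (0 < a)%N.
  rewrite lt0n; apply: contra_neq e3n0 => a0; apply: hl_norm_eq0 => //.
  by rewrite E33 a0.
pose e := [tuple e1; e2; e3].
have gramE i j : H (tnth e i) (tnth e j) = (nth 0%N [:: 1; 1; a]%N i)%:R *+ (i == j).
  by move: i j; apply: ord3P; apply: ord3P => /=.
have e_mem i : hl_mem (tnth e i) by move: i; apply: ord3P.
have [] := @orthogonal_basis 3 e L_ternary e_mem.
- by apply: ord3P; rewrite gramE /= ?oner_neq0 //; apply/eqP=> /(@quad_natr_inj _ a 0) a0;
    rewrite a0 in a_gt0.
- by move=> i j /negPf ij; rewrite gramE ij.
move=> free_e expand; exists a, e; split=> //; last first.
  by apply/matrixP=> i j; rewrite !mxE gramE.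
split; last first.
  move=> c _; under eq_bigr do rewrite (tnth_nth 0).
  exact: (freeP free_e).
move=> x; split=> [xL|[c cO ->]]; last first.
  by apply: int_span_sum => i; apply: int_span_scale (cO i) (e_mem i).
have PxL := P_mem _ xL.
have aC : \val (a%:R : quadField m) = a%:R by rewrite val_natr.
have [q qO [t tE t_lt1]] := quad_euclid m_in (H (P x) e3 / a%:R).
have PxE : P x = (H (P x) e3 / a%:R) *: e3.
  rewrite [LHS]expand // !big_ord_recl big_ord0 /= !(tnth_nth 0) /=.
  by rewrite Pe1 Pe2 E33 !mul0r !scale0r !add0r addr0.
have Pxq : P x = q *: e3.
  pose z := P x - q *: e3; apply/eqP; rewrite -subr_eq0 -/z.
  apply: contraT => z_neq0.
  have zL : hl_mem z by apply: int_span_sub PxL (int_span_scale qO e3L).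
  have [n nE] := hl_norm_nat zL.
  have : attained n.
    apply/asboolP; exists z => //; split=> //.
      by rewrite linearBl /= herm_scalel Pe1 E31 mulr0 subr0.
    by rewrite linearBl /= herm_scalel Pe2 E32 mulr0 subr0.
  move/a_min; rewrite leqNgt => /negP[].
  have : \val (H z z) = ratr t * a%:R.
    rewrite /z PxE -scalerBl herm_scalel herm_scaler E33 mulrA.
    by rewrite -tE -aC -rmorphM.
  rewrite nE val_natr -(ratr_nat _ n) -(ratr_nat _ a) -rmorphM => /fmorph_inj nE'.
  rewrite -(ltr_nat rat) nE' -[ltRHS]mul1r ltr_pM2r // ltr0n //.
exists (fun i : 'I_3 => [:: H x e1; H x e2; q]`_i).
  by apply: ord3P; rewrite /= ?hl_integral.
rewrite !big_ord_recl big_ord0 /= !(tnth_nth 0) /= addr0 -Pxq /P.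
by rewrite addrA addrC subrK.
Qed.

End Splitting.

(** * Elements of small norm *)

Section SmallNorms.
Local Open Scope ring_scope.
Variable m : nat.
Hypothesis m_in : m \in [:: 1; 2; 3; 7; 11]%N.
Implicit Types x y : quadField m.

Lemma quad_norm_nat x : x \in quad_int m -> exists n : nat, x * quad_conj x = n%:R.
Proof. by move=> /(quad_int_coords m_in)[_ [_ [n [_ ? _]]]]; exists n. Qed.

Lemma quad_norm_sqr x (n : nat) : x \in quad_int m -> x * quad_conj x = n%:R ->
  exists A B : int, x *+ 2 = A%:~R + B%:~R * quad_sqrt m /\
    A ^+ 2 + m%:Z * B ^+ 2 = 4 * n%:Z.
Proof.
move=> /(quad_int_coords m_in)[A [B [k [xE kE AB]]]] nE; exists A, B; split=> //.
by move: nE; rewrite kE => /quad_natr_inj <-.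
Qed.

(** Neither A^2 + B^2 = 12 nor A^2 + 7 B^2 = 12 has integral solutions. *)
Lemma norm_neq3 x : m \in [:: 1; 7]%N -> x \in quad_int m ->
  x * quad_conj x <> 3%:R.
Proof.
move=> m17 xO /(quad_norm_sqr xO)[A [B [_]]].
rewrite !expr2 => AB.
have B_le : -3 <= B <= 3 by move: m17 AB; rewrite !inE => /orP[] /eqP->; nia.
have A_le : -3 <= A <= 3 by move: m17 AB; rewrite !inE => /orP[] /eqP->; nia.
have : B = -3 \/ B = -2 \/ B = -1 \/ B = 0 \/ B = 1 \/ B = 2 \/ B = 3 by lia.
have : A = -3 \/ A = -2 \/ A = -1 \/ A = 0 \/ A = 1 \/ A = 2 \/ A = 3 by lia.
by move: m17 AB; rewrite !inE => /orP[] /eqP-> AB;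
  move=> [|[|[|[|[|[|]]]]]] A0; rewrite A0 in AB;
  move=> [|[|[|[|[|[|]]]]]] B0; rewrite B0 in AB.
Qed.

(** A^2 + 3 B^2 = 8 has no integral solutions. *)
Lemma norm_neq2 x : m = 3%N -> x \in quad_int m -> x * quad_conj x <> 2%:R.
Proof.
move=> m3 xO /(quad_norm_sqr xO)[A [B [_]]]; rewrite m3 !expr2 => AB.
have B_le : -1 <= B <= 1 by nia.
have A_le : -2 <= A <= 2 by nia.
have : B = -1 \/ B = 0 \/ B = 1 by lia.
have : A = -2 \/ A = -1 \/ A = 0 \/ A = 1 \/ A = 2 by lia.
by move=> [|[|[|[|]]]] A0; rewrite A0 in AB; move=> [|[|]] B0; rewrite B0 in AB.
Qed.

Lemma quad_mul2_inj : injective (fun x => x *+ 2).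
Proof.
move=> x y /eqP; rewrite -subr_eq0 -mulrnBl -mulr_natl mulf_eq0 subr_eq0.
by case/orP=> [/eqP /(@quad_natr_inj _ 2 0)|/eqP].
Qed.

(** Let 2 x = A + B sqrt(-m). For m = 11, A^2 + 11 B^2 <= 8 forces B = 0. For
    m = 2, A^2 + 2 B^2 <= 8 is divisible by 4, so that B = 0 or
    (A, B) = (0, 2) or (0, -2), where x is a square root of -2. *)
Lemma norm_le2 x (n : nat) : m \in [:: 2; 11]%N -> x \in quad_int m ->
  x * quad_conj x = n%:R -> (n <= 2)%N ->
  quad_conj x = x \/ quad_conj x = - x /\ n = 2%N.
Proof.
move=> m211 xO nE n_le2; have [A [B [xE]]] := quad_norm_sqr xO nE.
rewrite !expr2 => AB.
have [x2 | [A0 n2]] : B = 0 \/ A = 0 /\ n = 2%N.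
  have B_le : -2 <= B <= 2 by move: m211 AB; rewrite !inE => /orP[] /eqP->; nia.
  have A_le : -2 <= A <= 2 by move: m211 AB; rewrite !inE => /orP[] /eqP->; nia.
  have : B = -2 \/ B = -1 \/ B = 0 \/ B = 1 \/ B = 2 by lia.
  have : A = -2 \/ A = -1 \/ A = 0 \/ A = 1 \/ A = 2 by lia.
  by move: m211 AB; rewrite !inE => /orP[] /eqP-> AB;
    move=> [|[|[|[|]]]] A0; rewrite A0 in AB *;
    move=> [|[|[|[|]]]] B0; rewrite B0 in AB *; lia.
- left; apply: quad_mul2_inj; rewrite -rmorphMn /= xE x2 mul0r addr0.
  exact: rmorph_int.
right; split=> //; apply: quad_mul2_inj; rewrite mulNrn -rmorphMn /= xE A0 add0r.
by rewrite rmorphM rmorph_int /= (quad_conj_sqrt (m_gt0 m_in)) mulrN.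
Qed.

End SmallNorms.

(** * The form <1,1,a> *)

Section TernaryForm.
Local Open Scope ring_scope.
Variables (m a : nat).
Hypothesis m_in : m \in [:: 1; 2; 3; 7; 11]%N.
Implicit Types x y : 'I_3 -> quadField m.

Definition herm3 x y : quadField m :=
  x 0 * quad_conj (y 0) + x 1 * quad_conj (y 1) +
  a%:R * (x 2%:R * quad_conj (y 2%:R)).

Lemma herm3_conj x y : quad_conj (herm3 x y) = herm3 y x.
Proof.
rewrite /herm3 !rmorphD !rmorphM /= rmorph_nat !quad_conjK.
by congr (_ + _ + _ * _); rewrite mulrC.
Qed.

Lemma herm3_norms x (n : nat) : (forall i, x i \in quad_int m) ->
  herm3 x x = n%:R -> exists n0 n1 n2 : nat,
  [/\ x 0 * quad_conj (x 0) = n0%:R, x 1 * quad_conj (x 1) = n1%:R,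
      x 2%:R * quad_conj (x 2%:R) = n2%:R & (n0 + n1 + a * n2 = n)%N].
Proof.
move=> xO; rewrite /herm3.
have [n0 ->] := quad_norm_nat m_in (xO 0).
have [n1 ->] := quad_norm_nat m_in (xO 1).
have [n2 ->] := quad_norm_nat m_in (xO 2%:R).
rewrite -natrM -!natrD => /quad_natr_inj nE.
by exists n0, n1, n2.
Qed.

Lemma quad_norm0 (z : quadField m) : z * quad_conj z = 0 -> z = 0.
Proof. by move/eqP; rewrite quad_norm_eq0 => /eqP. Qed.

(** The Gram determinant of two vectors of O^2 is the norm of the determinant
    of their coordinates. *)
Lemma herm3_lagrange x y : x 2%:R = 0 -> y 2%:R = 0 ->
  let d := x 0 * y 1 - x 1 * y 0 in
  d * quad_conj d = herm3 x x * herm3 y y - herm3 x y * quad_conj (herm3 x y).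
Proof.
move=> x2 y2; rewrite herm3_conj /herm3 x2 y2 rmorphB !rmorphM /=.
by rewrite rmorph0; ring.
Qed.

(** If x2 is nonzero, the norm 2 of x leaves room only for a = 2, x0 = x1 = 0.
    Then 2 x2 y2' = 1, where y2' is the conjugate, and taking norms shows that 4 divides 1. *)
Lemma third_coord_eq0 x y : (2 <= a)%N -> (forall i, x i \in quad_int m) ->
  (forall i, y i \in quad_int m) -> herm3 x x = 2%:R -> herm3 x y = 1 ->
  x 2%:R = 0.
Proof.
move=> a_ge2 xO yO xx xy.
have [n0 [n1 [n2 [N0 N1 N2 nE]]]] := herm3_norms xO xx.
case: n2 => [|n2] in N2 nE; first exact: quad_norm0.
have n00 : n0 = 0%N by nia.
have n10 : n1 = 0%N by nia.
have a2 : a = 2%N by nia.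
rewrite n00 in N0; rewrite n10 in N1.
move: xy; rewrite /herm3 (quad_norm0 N0) (quad_norm0 N1) !mul0r !add0r a2 => xy.
have [k kE] := quad_norm_nat m_in (yO 2%:R).
have : (4 * n2.+1 * k)%:R = 1%:R :> quadField m.
  rewrite !natrM -N2 -kE; move: (x 2%:R) (y 2%:R) xy => u v uv.
  transitivity ((2%:R * (u * quad_conj v)) * quad_conj (2%:R * (u * quad_conj v))).
    by rewrite !rmorphM /= rmorph_nat quad_conjK; ring.
  by rewrite uv rmorph1 mulr1.
move=> /quad_natr_inj; lia.
Qed.

(** The third coordinates vanish, so the determinant 3 would be a norm. *)
Lemma no_binary_2112 x y : m \in [:: 1; 7]%N -> (2 <= a)%N ->
  (forall i, x i \in quad_int m) -> (forall i, y i \in quad_int m) ->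
  herm3 x x = 2%:R -> herm3 y y = 2%:R -> herm3 x y = 1 -> False.
Proof.
move=> m17 a_ge2 xO yO xx yy xy.
have yx : herm3 y x = 1 by rewrite -herm3_conj xy rmorph1.
have x2 := third_coord_eq0 a_ge2 xO yO xx xy.
have y2 := third_coord_eq0 a_ge2 yO xO yy yx.
have := herm3_lagrange x2 y2; rewrite xx yy xy rmorph1 /=.
have -> : 2%:R * 2%:R - 1 * 1 = 3%:R :> quadField m by ring.
by apply: norm_neq3 => //; rewrite rpredB ?rpredM.
Qed.

(** As a exceeds both norms, the third coordinates vanish, so the determinant
    2 would be a norm. *)
Lemma no_diag_1_2 x y : m = 3%N -> (3 <= a)%N ->
  (forall i, x i \in quad_int m) -> (forall i, y i \in quad_int m) ->
  herm3 x x = 1%:R -> herm3 y y = 2%:R -> herm3 x y = 0 -> False.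
Proof.
move=> m3 a_ge3 xO yO xx yy xy.
have third0 z (n : nat) : (n <= 2)%N -> (forall i, z i \in quad_int m) ->
    herm3 z z = n%:R -> z 2%:R = 0.
  move=> n_le2 zO zz; have [n0 [n1 [n2 [_ _ N2 nE]]]] := herm3_norms zO zz.
  by apply: quad_norm0; rewrite N2; have -> : n2 = 0%N by nia.
have x2 := third0 x 1%N isT xO xx.
have y2 := third0 y 2%N isT yO yy.
have := herm3_lagrange x2 y2; rewrite xx yy xy mul0r subr0 mul1r.
by apply: norm_neq2 => //; rewrite rpredB ?rpredM.
Qed.

(** By [norm_le2] each coordinate is fixed or negated. A coordinate that is
    negated and not fixed has norm 2, and then the other coordinates are 0, to
    which either sign applies. *)
Lemma herm3_norm2_conj x : m \in [:: 2; 11]%N -> (0 < a)%N ->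
  (forall i, x i \in quad_int m) -> herm3 x x = 2%:R ->
  exists s : bool, forall i, quad_conj (x i) = (-1) ^+ s * x i.
Proof.
move=> m211 a_gt0 xO xx.
have [n0 [n1 [n2 [N0 N1 N2 nE]]]] := herm3_norms xO xx.
have [n0_le2 n1_le2 n2_le2] : [/\ n0 <= 2, n1 <= 2 & n2 <= 2]%N by split; nia.
have c0 := norm_le2 m_in m211 (xO 0) N0 n0_le2.
have c1 := norm_le2 m_in m211 (xO 1) N1 n1_le2.
have c2 := norm_le2 m_in m211 (xO 2%:R) N2 n2_le2.
have real_or : [\/ forall i, quad_conj (x i) = x i | forall i, quad_conj (x i) = - x i].
  have zero (z : quadField m) : z * quad_conj z = 0 -> quad_conj z = - z.
    by move/quad_norm0=> ->; rewrite rmorph0 oppr0.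
  case: c0 => [c0|[c0 n0E]]; last first.
    have [n10 n20] : n1 = 0%N /\ n2 = 0%N by nia.
    rewrite n10 in N1; rewrite n20 in N2.
    by right; apply: ord3P; [| exact: zero | exact: zero].
  case: c1 => [c1|[c1 n1E]]; last first.
    have [n00 n20] : n0 = 0%N /\ n2 = 0%N by nia.
    rewrite n00 in N0; rewrite n20 in N2.
    by right; apply: ord3P; [exact: zero | | exact: zero].
  case: c2 => [c2|[c2 n2E]]; first by left; apply: ord3P.
  have [n00 n10] : n0 = 0%N /\ n1 = 0%N by nia.
  rewrite n00 in N0; rewrite n10 in N1.
  by right; apply: ord3P; [exact: zero | exact: zero |].
by case: real_or => xc; [exists false | exists true] => i;
  rewrite xc ?expr0 ?expr1 ?mul1r ?mulN1r.
Qed.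

Lemma norm2_pair_conj x y : m \in [:: 2; 11]%N -> (0 < a)%N ->
  (forall i, x i \in quad_int m) -> (forall i, y i \in quad_int m) ->
  herm3 x x = 2%:R -> herm3 y y = 2%:R ->
  exists s : bool, quad_conj (herm3 x y) = (-1) ^+ s * herm3 x y.
Proof.
move=> m211 a_gt0 xO yO xx yy.
have [s xs] := herm3_norm2_conj m211 a_gt0 xO xx.
have [t yt] := herm3_norm2_conj m211 a_gt0 yO yy.
exists (s (+) t); rewrite signr_addb herm3_conj /herm3 !xs !yt.
have signK (u : bool) : (-1) ^+ u * (-1) ^+ u = 1 :> quadField m by case: u; ring.
move: (signK t); move: (_ ^+ s) (_ ^+ t) => e f ff.
have {}ff : f * f = 1 by [].
ring: ff.
Qed.

End TernaryForm.

(** * Test lattices *)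

Section Tests.
Local Open Scope ring_scope.
Variable m : nat.
Hypothesis m_in : m \in [:: 1; 2; 3; 7; 11]%N.

(** The element b is 1 + sqrt(-2) for m = 2 and (1 + sqrt(-11)) / 2 for m = 11:
    both are (k + k sqrt(-m)) / 2 with k^2 (m + 1) = 12, that is, of norm 3. *)
Lemma norm3_entry : m \in [:: 2; 11]%N -> exists b : quadField m,
  [/\ b \in quad_int m, b * quad_conj b = 3%:R &
      forall s : bool, quad_conj b <> (-1) ^+ s * b].
Proof.
move=> m211.
have [k kE] : exists k : nat, (k ^ 2 * m.+1 = 12)%N.
  by move: m211; rewrite !inE => /orP[] /eqP->; [exists 2%N | exists 1%N].
have two0 : 2%:R != 0 :> quadField m by apply/eqP=> /(@quad_natr_inj m 2 0).
pose b : quadField m := (k%:~R + k%:~R * quad_sqrt m) / 2%:R.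
have bcE : quad_conj b = (k%:~R - k%:~R * quad_sqrt m) / 2%:R.
  rewrite /b fmorph_div rmorphD rmorphM /= !rmorph_nat.
  by rewrite (quad_conj_sqrt (m_gt0 m_in)) mulrN.
have bbE : b * quad_conj b = 3%:R.
  rewrite bcE; apply: (mulfI two0); apply: (mulfI two0).
  transitivity (k%:R ^+ 2 * (1 - quad_sqrt m * quad_sqrt m)); first by rewrite /b; field.
  rewrite quad_sqrtK opprK -natrX -[1 + _]/(1%:R + _) -natrD -natrM add1n kE.
  by rewrite -!natrM.
exists b; split=> //.
  apply: quad_half_int => //; apply/dvdzP; exists 3.
  by have := kE; nia.
have k0 : k%:R != 0 :> quadField m.
  apply/eqP=> /(@quad_natr_inj m k 0) k0; by rewrite k0 in kE.
case=> bc.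
  have : b + quad_conj b = 0 by rewrite bc expr1 mulN1r subrr.
  suff -> : b + quad_conj b = k%:R by move/eqP: k0.
  by rewrite bcE /b; field.
have : b - quad_conj b = 0 by rewrite bc expr0 mul1r subrr.
have -> : b - quad_conj b = k%:R * quad_sqrt m by rewrite bcE /b; field.
move/eqP; rewrite mulf_eq0 (negPf k0) /= => /eqP s0.
have := quad_sqrtK m; rewrite s0 mul0r => /eqP; rewrite eq_sym oppr_eq0.
by move=> /eqP/(@quad_natr_inj m m 0) m0; move: m_in; rewrite m0.
Qed.

(** The two vectors given by [universal_pair], written in the orthogonal basis
    of L. *)
Lemma universal_coords (L : hermLattice m) (a : nat) (e : 3.-tuple (hl_space L))
    (p r D : nat) (b : quadField m) :
    two_universal L -> lattice_basis e ->
    gram e = diag_mx (\row_i (nth 0%N [:: 1; 1; a]%N i)%:R) ->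
    (0 < p)%N -> (0 < D)%N -> b \in quad_int m ->
    b * quad_conj b + D%:R = (p * r)%:R ->
  exists x y : 'I_3 -> quadField m,
    [/\ (forall i, x i \in quad_int m), (forall i, y i \in quad_int m),
      herm3 a x x = p%:R, herm3 a y y = r%:R & herm3 a x y = b].
Proof.
move=> L_univ [e_span _] gramE p_gt0 D_gt0 bO detE.
have [u [v [/e_span[x xO ->] /e_span[y yO ->] xx yy xy]]] :=
  universal_pair p_gt0 D_gt0 bO detE L_univ.
have formE c d : hl_form L (\sum_i c i *: tnth e i) (\sum_i d i *: tnth e i) =
    herm3 a c d.
  have eE i j : hl_form L (tnth e i) (tnth e j) =
      (nth 0%N [:: 1; 1; a]%N i)%:R *+ (i == j).
    by have := congr1 (fun M : 'M_3 => M i j) gramE; rewrite !mxE.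
  rewrite herm_sum !big_ord_recl !big_ord0 !eE /= /herm3.
  rewrite (_ : lift ord0 ord0 = 1); last exact: val_inj.
  rewrite (_ : lift ord0 _ = 2%:R); last exact: val_inj.
  by rewrite -[ord0]/(0 : 'I_3) !mulr0n !mulr1n; ring.
by exists x, y; rewrite -!formE.
Qed.

End Tests.

Theorem mainTheorem2 (m : nat) (m_in : m \in [:: 1; 2; 3; 7; 11])
  (L : hermLattice m) (L_ternary : hl_rank L = 3)
  (L_universal : two_universal L) :
  (m = 1 /\ isometric L (diag_lattice m [:: 1; 1; 1] isT)) \/
  (m = 3 /\ (isometric L (diag_lattice m [:: 1; 1; 1] isT) \/
             isometric L (diag_lattice m [:: 1; 1; 2] isT))) \/
  (m = 7 /\ isometric L (diag_lattice m [:: 1; 1; 1] isT)).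
Proof.
have [a [e [a_gt0 e_basis gramE]]] := split_two_units m_in L_ternary L_universal.
have coords p r D b := @universal_coords m L a e p r D b L_universal e_basis gramE.
have [m211 | m137] := boolP (m \in [:: 2; 11]).
  have [b [bO bE b_conj]] := norm3_entry m_in m211.
  have [|x [y [xO yO xx yy xy]]] := coords 2 2 1 b isT isT bO.
    by rewrite bE -natrD.
  have [s sE] := norm2_pair_conj m_in m211 a_gt0 xO yO xx yy.
  by case: (b_conj s); rewrite -xy.
have [m17 | m3] := boolP (m \in [:: 1; 7]).
  have a1 : a = 1.
    have [//|a_ge2] : a = 1 \/ 2 <= a by lia.
    have [|x [y [xO yO xx yy xy]]] := coords 2 2 3 1%R isT isT (rpred1 _).
      by rewrite rmorph1 mulr1 -[X in (X + _)%R]/(1%:R)%R -natrD.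
    by case: (no_binary_2112 m_in m17 a_ge2 xO yO xx yy xy).
  subst a; have iso := @isometric_diag m L [:: 1; 1; 1] isT e e_basis gramE.
  by move: m17; rewrite !inE => /orP[] /eqP mE; [left | right; right].
have mE : m = 3 by move: m_in m137 m3; rewrite !inE; lia.
have a_le2 : a <= 2.
  rewrite leqNgt; apply/negP=> a_ge3.
  have [|x [y [xO yO xx yy xy]]] := coords 1 2 2 0%R isT isT (rpred0 _).
    by rewrite mul0r add0r.
  exact: (no_diag_1_2 m_in mE a_ge3 xO yO xx yy xy).
right; left; split=> //.
have [a1|a2] : a = 1 \/ a = 2 by lia.
  by subst a; left; exact: (@isometric_diag m L [:: 1; 1; 1] isT e).
by subst a; right; exact: (@isometric_diag m L [:: 1; 1; 2] isT e).
Qed.
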